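(* Let $1\leq p<\infty$ and let $$S_p=\{f\in L^p[0,1] : f \text{ is nowhere } L^q \text{ for each } q \text{ with } p<q\leq\infty\}.$$ Then $S_p\cup\{0\}\subset L^p[0,1]$ contains an isometric and complemented copy of $\ell_p$; that is, there is a closed linear subspace $V$ of $L^p[0,1]$ with $V\subset S_p\cup\{0\}$ such that $V$ is linearly isometric to $\ell_p$ and $V$ is complemented in $L^p[0,1]$. In particular, $S_p$ is spaceable in $L^p[0,1]$.
   Context: $L^p[0,1]$ is the space of (classes of) real-valued functions on $[0,1]$ with Lebesgue measure, with its usual norm. A function $f:[0,1]\to\mathbb{R}$ is said to be nowhere $L^q$, for some $1\leq q\leq\infty$, if for each nonvoid open subset $U$ of $[0,1]$ the restriction $f|_U$ is not in $L^q(U)$. A subset $S$ of a topological vector space $X$ is spaceable if $S\cup\{0\}$ contains a closed infinite-dimensional linear subspace of $X$. A closed subspace $V$ of a Banach space $X$ is complemented if it is the range of a bounded linear projection $X\to X$. *)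

(* Defs.v *)
From HB Require Import structures.
From mathcomp Require Import all_boot all_order all_algebra.
From mathcomp Require Import finmap.
From mathcomp Require Import all_classical all_reals ereal topology normedtype.
From mathcomp Require Import sequences measure ess_sup_inf measurable_realfun.
From mathcomp Require Import lebesgue_measure lebesgue_integral numfun exp hoelder.

Set Implicit Arguments.
Unset Strict Implicit.
Unset Printing Implicit Defensive.
Import Order.TTheory GRing.Theory Num.Theory.
Import numFieldNormedType.Exports.

Local Open Scope classical_set_scope.
Local Open Scope ring_scope.

(* MathComp-Analysis defines L^p(mu) as [LspaceType mu p1], the type of classes
   of measurable functions modulo mu-a.e. equality with finite p-norm, but gives
   it no algebraic or normed structure. This section makes it a normed module:
   the operations are the pointwise ones on representatives and the norm is
   'N[mu]_p. *)
Section Lspace_normedModType.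
Context d (T : measurableType d) (R : realType).
Variables (mu : {measure set T -> \bar R}) (p : \bar R) (p1 : (1 <= p)%E).

Local Notation Lp := (LspaceType mu p1).
Local Notation Lf := (LfunType mu p1).
Local Notation mfq := (@aeEqMfun _ _ R T (measurableTypeR R) mu).

Lemma ae_eq_Lnorm (f g : T -> R) :
  measurable_fun setT f -> measurable_fun setT g -> f = g %[ae mu] ->
  ('N[mu]_p[EFin \o f] = 'N[mu]_p[EFin \o g])%E.
Proof.
move=> mf mg fg; rewrite unlock /Lnorm.
have mpow r (h : T -> R) : measurable_fun setT h ->
    measurable_fun setT (fun x => (`|(EFin \o h) x| `^ r)%E).
  move=> mh; rewrite -[X in measurable_fun _ X]/(EFin \o (fun x => `|h x| `^ r)).
  apply/measurable_EFinP.
  apply: (@measurableT_comp _ _ _ _ _ _ (@powR R ^~ r)) => //.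
  exact: measurableT_comp.
case: p p1 => [r _|_|p_ge1]; last by rewrite leeNy_eq in p_ge1.
- apply: (congr1 (fun z : \bar R => z `^ r^-1)%E).
  apply: (ae_eq_integral _ _ measurableT (mpow r f mf) (mpow r g mg)).
  by apply: filterS fg => x + _ => /(_ I) /= ->.
- case: ifP => [_|_]; last by [].
  apply: (@eq_ess_sup _ _ _ mu).
  by apply: filterS fg => x /(_ I) /= ->.
Qed.

Lemma Lspace_repr_subproof (f : Lp) : (f : T -> R) \in Lfun mu p.
Proof.
apply/andP; split; rewrite inE /=.
  exact: (@measurable_funP _ _ _ _ setT (repr (f : mfq))).
exact: Lebesgue_finite.
Qed.

Definition Lspace_repr (f : Lp) : Lf := Lfun_Sub p1 (Lspace_repr_subproof f).

(* The library's L^p uses [measurableTypeR R] as codomain, the alias of R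
   carrying the same (Borel) sigma-algebra under a different display. *)
Definition Lfun_measurableTypeR (f : Lf) : {mfun T >-> measurableTypeR R} :=
  HB.pack_for {mfun T >-> measurableTypeR R} (f : T -> measurableTypeR R)
    (isMeasurableFun.Build _ _ T (measurableTypeR R) (f : T -> R)
      (@measurable_funP _ _ T R setT f)).

Definition Lspace_pi_subdef (f : Lf) : mfq :=
  (\pi_mfq (Lfun_measurableTypeR f))%qT.

Lemma Lspace_pi_subdefE (f : Lf) : (Lspace_pi_subdef f : T -> R) = f %[ae mu].
Proof.
apply/asboolP.
have : ((repr (Lspace_pi_subdef f)) = Lfun_measurableTypeR f %[mod mfq])%qT by rewrite reprK.
by move/eqmodP.
Qed.

Lemma Lspace_pi_subproof (f : Lf) : finite_norm mu p (Lspace_pi_subdef f).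
Proof.
rewrite /finite_norm (@ae_eq_Lnorm _ f); first exact: Lfunction_finite.
- exact: (@measurable_funP _ _ _ _ setT (repr (Lspace_pi_subdef f))).
- exact: measurable_funP.
- exact: Lspace_pi_subdefE.
Qed.

Definition Lspace_pi (f : Lf) : Lp :=
  HB.pack_for Lp (Lspace_pi_subdef f)
    (@isFinLebesgue.Build _ _ _ mu p p1 (Lspace_pi_subdef f)
      (Lspace_pi_subproof f)).

Lemma Lspace_piE (f : Lf) : (Lspace_pi f : T -> R) = f %[ae mu].
Proof. exact: Lspace_pi_subdefE. Qed.

Lemma LspaceP (f g : Lp) : f = g <-> (f : T -> R) = g %[ae mu].
Proof.
split=> [->|]; first exact: ae_eq_refl.
case: f g => [f [[ff]]] [g [[gf]]] /= fg.
have {}fg : f = g.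
  rewrite -(reprK f) -(reprK g); apply/eqmodP; exact/asboolP.
by subst g; congr (LebesgueSpace.Pack (LebesgueSpace.Class _)); congr isFinLebesgue.Axioms_; exact: Prop_irrelevance.
Qed.

Lemma Lspace_pi_eq (f g : Lf) :
  (f : T -> R) = g %[ae mu] -> Lspace_pi f = Lspace_pi g.
Proof.
move=> fg; apply/LspaceP; have := Lspace_piE f; have := Lspace_piE g.
by move: fg; apply: filterS3 => x + + + _ => /(_ I)-> /(_ I)-> /(_ I)->.
Qed.

Lemma Lspace_reprK (f : Lp) : Lspace_pi (Lspace_repr f) = f.
Proof. by apply/LspaceP; exact: Lspace_piE. Qed.

Lemma Lspace_pi_surj (f : Lp) : exists g : Lf, f = Lspace_pi g.
Proof. by exists (Lspace_repr f); rewrite Lspace_reprK. Qed.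

Definition Lspace_zero : Lp := Lspace_pi 0.
Definition Lspace_opp (f : Lp) : Lp := Lspace_pi (- Lspace_repr f).
Definition Lspace_add (f g : Lp) : Lp :=
  Lspace_pi (Lspace_repr f + Lspace_repr g).
Definition Lspace_scale (a : R) (f : Lp) : Lp := Lspace_pi (a *: Lspace_repr f).
Definition Lspace_norm (f : Lp) : R := fine ('N[mu]_p[EFin \o f])%E.

Let piN (f : Lf) : Lspace_opp (Lspace_pi f) = Lspace_pi (- f).
Proof.
apply: Lspace_pi_eq; apply: filterS (Lspace_piE f) => x /(_ I) fx _.
exact: (congr1 -%R fx).
Qed.

Let piD (f g : Lf) : Lspace_add (Lspace_pi f) (Lspace_pi g) = Lspace_pi (f + g).
Proof.
apply: Lspace_pi_eq; apply: filterS2 (Lspace_piE f) (Lspace_piE g) => x.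
by move=> /(_ I) fx /(_ I) gx _; exact: (f_equal2 +%R fx gx).
Qed.

Let piZ (a : R) (f : Lf) : Lspace_scale a (Lspace_pi f) = Lspace_pi (a *: f).
Proof.
apply: Lspace_pi_eq; apply: filterS (Lspace_piE f) => x /(_ I) fx _.
exact: (congr1 ( *%R a) fx).
Qed.

Let pi_norm (f : Lf) : Lspace_norm (Lspace_pi f) = fine ('N[mu]_p[EFin \o f])%E.
Proof.
rewrite /Lspace_norm (@ae_eq_Lnorm _ f) //; last exact: Lspace_piE.
exact: (@measurable_funP _ _ _ _ setT (repr (Lspace_pi_subdef f))).
Qed.

Let addA : associative Lspace_add.
Proof.
move=> f g h; have [f' ->] := Lspace_pi_surj f; have [g' ->] := Lspace_pi_surj g.
by have [h' ->] := Lspace_pi_surj h; rewrite !piD addrA.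
Qed.

Let addC : commutative Lspace_add.
Proof. by move=> f g; rewrite /Lspace_add addrC. Qed.

Let add0 : left_id Lspace_zero Lspace_add.
Proof. by move=> f; have [f' ->] := Lspace_pi_surj f; rewrite piD add0r. Qed.

Let addN : left_inverse Lspace_zero Lspace_opp Lspace_add.
Proof.
by move=> f; have [f' ->] := Lspace_pi_surj f; rewrite piN piD addNr.
Qed.

HB.instance Definition _ := gen_eqMixin Lp.
HB.instance Definition _ := gen_choiceMixin Lp.
HB.instance Definition _ := GRing.isZmodule.Build Lp addA addC add0 addN.

Let scaleA a b (f : Lp) :
  Lspace_scale a (Lspace_scale b f) = Lspace_scale (a * b) f.
Proof. by have [f' ->] := Lspace_pi_surj f; rewrite !piZ scalerA. Qed.

Let scale1 : left_id 1 Lspace_scale.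
Proof. by move=> f; have [f' ->] := Lspace_pi_surj f; rewrite piZ scale1r. Qed.

Let scaleDr : right_distributive Lspace_scale +%R.
Proof.
move=> a f g; have [f' ->] := Lspace_pi_surj f; have [g' ->] := Lspace_pi_surj g.
by rewrite -[X in _ = X]/(Lspace_add _ _) -[X in Lspace_scale _ X]/(Lspace_add _ _)
  !(piD, piZ) scalerDr.
Qed.

Let scaleDl (f : Lp) : {morph Lspace_scale^~ f : a b / a + b}.
Proof.
move=> a b; have [f' ->] := Lspace_pi_surj f.
by rewrite -[RHS]/(Lspace_add _ _) !(piD, piZ) scalerDl.
Qed.

HB.instance Definition _ :=
  GRing.Zmodule_isLmodule.Build R Lp scaleA scale1 scaleDr scaleDl.

Let ler_norm_add (f g : Lp) : Lspace_norm (f + g) <= Lspace_norm f + Lspace_norm g.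
Proof.
rewrite -[X in Lspace_norm X]/(Lspace_add _ _).
have [f' ->] := Lspace_pi_surj f; have [g' ->] := Lspace_pi_surj g.
by rewrite piD !pi_norm; exact: ler_LnormD.
Qed.

Let normZ (a : R) (f : Lp) : Lspace_norm (a *: f) = `|a| * Lspace_norm f.
Proof.
rewrite -[X in Lspace_norm X]/(Lspace_scale _ _).
have [f' ->] := Lspace_pi_surj f; rewrite piZ !pi_norm.
by apply: EFin_inj; rewrite EFinM !finite_norm_fine LnormZ.
Qed.

Let norm0_eq0 (f : Lp) : Lspace_norm f = 0 -> f = 0.
Proof.
have [f' ->] := Lspace_pi_surj f; rewrite pi_norm => /fine_Lnormr_eq0 f0.
exact: Lspace_pi_eq.
Qed.

HB.instance Definition _ :=
  Lmodule_isNormed.Build R Lp ler_norm_add normZ norm0_eq0.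

Lemma Lspace_normE (f : Lp) : (`|f|%:E = 'N[mu]_p[EFin \o f])%E.
Proof. exact: (finite_norm_fine (Lspace_repr f)). Qed.

Lemma LspaceDE (f g : Lp) : (f + g : Lp) = (f : T -> R) \+ g %[ae mu].
Proof. exact: Lspace_piE. Qed.

Lemma LspaceNE (f : Lp) : (- f : Lp) = \- (f : T -> R) %[ae mu].
Proof. exact: Lspace_piE. Qed.

Lemma LspaceZE (a : R) (f : Lp) : (a *: f : Lp) = a \*: (f : T -> R) %[ae mu].
Proof. exact: Lspace_piE. Qed.

Lemma Lspace0E : ((0 : Lp) : T -> R) = cst 0 %[ae mu].
Proof. exact: Lspace_piE. Qed.

End Lspace_normedModType.

Section subspaces.
Context (K : numFieldType).

Definition infinite_dimensional (E : lmodType K) (V : set E) : Prop :=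
  ~ exists (n : nat) (e : 'I_n -> E),
      (forall i, V (e i)) /\
      forall v, V v -> exists c : 'I_n -> K, v = \sum_(i < n) c i *: e i.

Definition spaceable (E : topologicalLmodType K) (S : set E) : Prop :=
  exists V : set E,
    [/\ closed V, submod_closed (mem V), infinite_dimensional V &
        V `<=` S `|` [set 0]].

Definition linearly_isometric (Y E : normedModType K) (V : set E) : Prop :=
  exists2 T : {linear Y -> E}, forall y, `|T y| = `|y| & range T = V.

Definition complemented (E : normedModType K) (V : set E) : Prop :=
  exists P : {linear E -> E},
    [/\ exists M : K, forall x, `|P x| <= M * `|x|,
        forall x, P (P x) = P x & range P = V].

End subspaces.
Arguments linearly_isometric {K} Y {E} V.

Section ell.
Context (R : realType) (p : R) (p1 : (1 <= p%:E)%E).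

(* l_p is L^p of the counting measure on nat; the lemmas below check that its
   elements are exactly the real sequences x with \sum_k |x_k|^p < +oo, with
   norm (\sum_k |x_k|^p)^(1/p). *)
Definition ell : normedModType R :=
  LspaceType (counting : {measure set nat -> \bar R}) p1.

Let p_gt0 : 0 < p.
Proof. by rewrite (lt_le_trans ltr01) // -lee_fin. Qed.

Let ell_ae (x y : R^nat) :
  x = y %[ae (counting : {measure set nat -> \bar R})] <-> forall k, x k = y k.
Proof.
split=> [[A [_ A0 xyA]] k|xy]; last by apply: aeW => k _.
apply: contrapT => xyk; have : A k by apply: xyA => /(_ I).
have -> : A = set0; last by [].
move: A0; rewrite /= /counting; case: ifPn => [/asboolP finA|//].
by move=> [] /eqP; rewrite pnatr_eq0 cardfs_eq0 => /eqP /(fset_set_set0 finA).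
Qed.

Lemma ellP (x y : ell) : x = y <-> forall k, x k = y k.
Proof. by rewrite LspaceP ell_ae. Qed.

Lemma ell_normE (x : ell) :
  (`|x|%:E = (\sum_(k <oo) (`|x k| `^ p)%:E) `^ p^-1)%E.
Proof. by rewrite Lspace_normE Lnorm_counting. Qed.

Lemma ell_exists (u : R^nat) : (\sum_(k <oo) (`|u k| `^ p)%:E < +oo)%E ->
  exists x : ell, forall k, x k = u k.
Proof.
move=> uoo; have uLp : u \in Lfun (@counting nat R) p%:E.
  apply/andP; split; rewrite inE //=.
  by rewrite /finite_norm Lnorm_counting //; exact: poweR_lty.
by exists (Lspace_pi (Lfun_Sub p1 uLp)); apply/ell_ae; exact: Lspace_piE.
Qed.

End ell.

Section nowhere_Lq.
Context (R : realType).

(* Functions on [0, 1] are represented by functions on R considered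
   almost everywhere for Lebesgue measure restricted to [0, 1]. *)
Definition lebesgue01 : {measure set (measurableTypeR R) -> \bar R} :=
  mrestr (@lebesgue_measure R) (measurable_itv `[0, 1]).

Definition L01 (p : R) (p1 : (1 <= p%:E)%E) : normedModType R :=
  LspaceType lebesgue01 p1.

Lemma measurable_relopen (O : set R) : open O ->
  measurable (`[0, 1]%classic `&` O : set (measurableTypeR R)).
Proof. by move=> oO; apply: measurableI => //; exact: open_measurable. Qed.

(* The open subsets of [0, 1] are the traces on [0, 1] of the open O. *)
Definition nowhere_Lfun (q : \bar R) (f : measurableTypeR R -> R) : Prop :=
  forall (O : set R) (oO : open O), `[0, 1]%classic `&` O !=set0 ->
    f \notin Lfun (mrestr lebesgue_measure (measurable_relopen oO)) q.

Lemma nowhere_Lfun_ae (q : \bar R) (f g : measurableTypeR R -> R) :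
  (1 <= q)%E -> measurable_fun setT f -> measurable_fun setT g ->
  f = g %[ae lebesgue01] -> nowhere_Lfun q f -> nowhere_Lfun q g.
Proof.
move=> q1 mf mg [A [mA A0 fgA]] nf O oO O0.
apply: contra (nf O oO O0) => /andP[_]; rewrite inE /= => gq.
apply/andP; split; rewrite inE //=; rewrite /finite_norm.
rewrite (ae_eq_Lnorm q1 mf mg) //; exists A; split => //.
apply/eqP; rewrite -measure_le0; apply: le_trans (_ : lebesgue01 A <= 0)%E.
  apply: le_measure; rewrite ?inE.
  - by apply: measurableI => //; exact: measurable_relopen.
  - exact: measurableI.
  - by move=> x [Ax [x01 _]].
by rewrite A0.
Qed.

Definition nowhere_Lq (p : R) (p1 : (1 <= p%:E)%E) : set (L01 p1) :=
  [set f | forall q : \bar R, (p%:E < q)%E -> nowhere_Lfun q f].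

End nowhere_Lq.
Arguments nowhere_Lq {R p} p1 _ : rename.

(* Main.v *)
(* Cut [0, 1], up to a null set, into sets [E_j] of positive measure at most
   4^-(j^2), labelled so that for each label [n] every nonempty open set contains
   [E_j] with label [n] and arbitrarily large [j]: [E_j] is what remains of a short
   interval near a rational [r_j] once all later intervals, of much smaller total
   length, are removed. Put on [E_j] a constant so high that the spikes with label
   [n] have p-th power integrals 1/2, 1/4, 1/8, ...; as [E_j] is so small, their q-th
   power integrals are unbounded for each q > p. The spikes with label [n] form a
   norm-one function [g_n], and [a |-> sum_n a_n g_n] is an isometry since the [g_n]
   have disjoint supports. By Hoelder, [f |-> (int f g_n^(p-1))_n] is a contractive
   left inverse of it, so its range is closed and complemented. *)
Require Import Defs.
From HB Require Import structures.
From mathcomp Require Import all_boot all_order all_algebra.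
From mathcomp Require Import all_classical all_reals ereal topology normedtype.
From mathcomp Require Import sequences measure ess_sup_inf measurable_realfun.
From mathcomp Require Import lebesgue_measure lebesgue_integral numfun exp hoelder.
From mathcomp Require Import ring lra zify.

Set Implicit Arguments.
Unset Strict Implicit.
Unset Printing Implicit Defensive.
Import Order.TTheory GRing.Theory Num.Theory.
Import numFieldNormedType.Exports.

Local Open Scope classical_set_scope.
Local Open Scope ring_scope.

(** * Isometries with a contractive linear left inverse *)

Section left_invertible_isometry.
Context (R : realType) (Y E : normedModType R).
Variables (J : {linear Y -> E}) (S : {linear E -> Y}).
Hypothesis S_contraction : forall x, `|S x| <= `|x|.
Hypothesis J_isometry : forall y, `|J y| = `|y|.
Hypothesis JK : cancel J S.

Let range_fixed : range J = [set x | J (S x) = x].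
Proof.
by apply/seteqP; split=> [_ [y _ <-]|x /= <-] /=; rewrite ?JK//; exists (S x).
Qed.

Lemma complemented_range : complemented (range J).
Proof.
exists (J \o S); split.
- by exists 1 => x; rewrite mul1r /= J_isometry.
- by move=> x /=; rewrite JK.
- apply/seteqP; split=> [_ [x _ <-]|_ [y _ <-]]; first by exists (S x).
  by exists (J y) => //=; rewrite JK.
Qed.

(** The projection [J \o S] is bounded, hence continuous, and the range is the set where it agrees
    with the identity. *)
Lemma closed_range : closed (range J).
Proof.
rewrite range_fixed.
have -> : [set x | J (S x) = x] = (fun x => J (S x) - x) @^-1` [set 0].
  by apply/seteqP; split=> x /= => [->|/eqP]; rewrite ?subrr// subr_eq0 => /eqP.
apply: preimage_closed; last first.
  exact: (accessible_closed_set1 (hausdorff_accessible (@norm_hausdorff _ _))).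
move=> x _; apply: cvgB; last exact: cvg_id.
apply: (@bounded_linear_continuous _ _ _ (J \o S)).
apply/bounded_funP => r; exists r => z zr /=.
by rewrite J_isometry (le_trans (S_contraction z)).
Qed.

End left_invertible_isometry.

(** * Ranges of linear maps *)

Lemma submod_closed_range (R : pzRingType) (Y E : lmodType R)
  (J : {linear Y -> E}) : submod_closed (mem (range J)).
Proof.
split; first by rewrite inE; exists 0 => //; rewrite linear0.
move=> a u v; rewrite !inE => -[x _ <-] [y _ <-].
by exists (a *: x + y) => //; rewrite linearP.
Qed.

(** If [n] vectors spanned the range, the coefficients of the [n.+1] images [J (e k)] would form a
    matrix with more rows than columns. A nonzero row in its left kernel would be a linear relation
    among the [e k], as [J] is injective. *)
Lemma infinite_dimensional_range (K : numFieldType) (Y E : lmodType K)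
    (J : {linear Y -> E}) (e : nat -> Y) : injective J ->
  (forall n (u : 'I_n -> K), \sum_(i < n) u i *: e i = 0 ->
    forall i, u i = 0) ->
  infinite_dimensional (range J).
Proof.
move=> J_inj e_free [n [v [_ vspan]]].
have /choice[c cE] : forall k : 'I_n.+1, exists c : 'I_n -> K,
    J (e k) = \sum_(i < n) c i *: v i.
  by move=> k; apply: vspan; exists (e k).
pose C := \matrix_(k < n.+1, i < n) c k i.
have : kermx C != 0.
  by rewrite kermx_eq0 -row_leq_rank -ltnNge ltnS rank_leq_col.
case/rowV0Pn => u /sub_kermxP uC; apply/negP; rewrite negbK; apply/eqP/rowP => k.
rewrite mxE; move: k; apply: (e_free _ (u 0)); apply: J_inj.
rewrite linear0 linear_sum /=.
under eq_bigr do rewrite linearZ /= cE scaler_sumr.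
rewrite exchange_big big1 //= => i _.
under eq_bigr do rewrite scalerA.
have : (u *m C) 0 i = 0 by rewrite uC mxE.
rewrite mxE -scaler_suml => uCi; rewrite -[RHS](scale0r (v i)) -[in RHS]uCi.
by congr (_ *: _); apply: eq_bigr => k _; rewrite mxE.
Qed.

(** * Coordinates and unit vectors in l_p *)

Section ell_coordinates.
Context (R : realType) (p : R) (p1 : (1 <= p%:E)%E).

Let p_neq0 : p != 0.
Proof. by rewrite gt_eqF// (lt_le_trans ltr01) // -lee_fin. Qed.

(** Only the empty set is null for the counting measure, so the almost-everywhere rules for the
    operations hold at every coordinate. *)
Lemma ae_counting (P : nat -> Prop) :
  (\forall k \ae (counting : {measure set nat -> \bar R}), P k) ->
  forall k, P k.
Proof.
move=> [A [_ A0 PA]] k; apply: contrapT => Pk; have : A k by exact: PA.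
have -> : A = set0; last by [].
move: A0; rewrite /= /counting; case: ifPn => [/asboolP finA|//].
move=> [] /eqP; rewrite pnatr_eq0 finmap.cardfs_eq0 => /eqP.
by move/(fset_set_set0 finA).
Qed.

Lemma ell_linE c (a b : ell p1) k : (c *: a + b : ell p1) k = c * a k + b k.
Proof.
move: k; apply: ae_counting.
by apply: filterS2 (LspaceDE (c *: a) b) (LspaceZE c a) => k /(_ I) -> /(_ I) /= ->.
Qed.

Lemma ell0E k : (0 : ell p1) k = 0.
Proof.
move: k; apply: ae_counting.
by apply: filterS (Lspace0E (counting : {measure set nat -> \bar R}) p1) => k /(_ I).
Qed.

Lemma ell_unit_exists n : exists e : ell p1, forall k, e k = (k == n)%:R.
Proof.
apply: (@ell_exists R p p1 (fun k => (k == n)%:R)).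
rewrite (@nneseriesD1 _ _ n)//.
rewrite eseries0 => [|k _ /andP[_ /negbTE ->]]; first by rewrite adde0 ltry.
by rewrite normr0 powR0.
Qed.

Lemma ell_sum_coord (n : nat) (u : 'I_n -> R) (e : nat -> ell p1) k :
  (\sum_(i < n) u i *: e i : ell p1) k = \sum_(i < n) u i * e i k.
Proof.
elim/big_rec2 : _ => [|i y x _ <-]; [exact: ell0E | exact: ell_linE].
Qed.

Lemma ell_unit_free (e : nat -> ell p1) :
  (forall n k, e n k = (k == n)%:R) -> forall n (u : 'I_n -> R),
  \sum_(i < n) u i *: e i = 0 -> forall i, u i = 0.
Proof.
move=> eE n u u0 i; have := congr1 (fun x : ell p1 => (x : nat -> R) i) u0.
rewrite ell_sum_coord (bigD1 i)//= eE eqxx mulr1 big1 => [|j ji]; last first.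
  by rewrite eE eq_sym (inj_eq val_inj) (negbTE ji) mulr0.
by rewrite addr0 ell0E.
Qed.

End ell_coordinates.

(** * The span of normalized functions with disjoint supports in L^p *)

Section block_basis.
Local Open Scope ereal_scope.
Context d (T : measurableType d) (R : realType) (mu : {measure set T -> \bar R}).
Variables (p : R) (p1 : 1 <= p%:E).

Let p_ge1 : (1 <= p)%R. Proof. by rewrite -lee_fin. Qed.
Let p_gt0 : (0 < p)%R. Proof. exact: lt_le_trans ltr01 p_ge1. Qed.
Let p_neq0 : (p != 0)%R. Proof. by rewrite gt_eqF. Qed.

Let measurable_normX (f : T -> R) (r : R) : measurable_fun setT f ->
  measurable_fun setT (fun x => (`|f x| `^ r)%:E).
Proof.
move=> mf; apply/measurable_EFinP.
apply: (@measurableT_comp _ _ _ _ _ _ (@powR R ^~ r)) => //.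
exact: measurableT_comp.
Qed.

(** Hoelder with the conjugate exponent [q = p / (p - 1)]: the q-th power of [g ^ (p - 1)] is
    [g ^ p], so this factor has q-norm 1 on [A]. *)
Lemma hoelder_duality (A : set T) (f g : T -> R) : measurable A ->
  measurable_fun setT f -> measurable_fun setT g -> (forall x, 0 <= g x)%R ->
  \int[mu]_(x in A) (g x `^ p)%:E = 1 ->
  \int[mu]_(x in A) `|(f x * g x `^ (p - 1))%:E| <=
    (\int[mu]_(x in A) (`|f x| `^ p)%:E) `^ p^-1.
Proof.
move=> mA mf mg g0 g1.
(* For [p = 1] the conjugate exponent is infinite, but then [g ^ (p - 1)] is the constant 1 and both
   sides agree. *)
have := p_ge1; rewrite le_eqVlt => /predU1P[<-|p_gt1].
  rewrite invr1 poweRe1; last first.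
    by apply: integral_ge0 => x _; rewrite lee_fin powR_ge0.
  rewrite subrr; under eq_integral do rewrite powRr0 mulr1.
  by under [leRHS]eq_integral do rewrite powRr1//.
have pB1_gt0 : (0 < p - 1)%R by rewrite subr_gt0.
pose q := (p / (p - 1))%R.
pose h x := (g x `^ (p - 1))%R.
have mh : measurable_fun setT h.
  exact: (@measurableT_comp _ _ _ _ _ _ (@powR R ^~ (p - 1)%R)).
have := @hoelder _ _ _ mu (f \_ A) (h \_ A) p q.
have q_gt0 : (0 < q)%R by rewrite divr_gt0.
have pq : (p^-1 + q^-1 = 1)%R by rewrite /q; field; rewrite !gt_eqF.
move=> /(_ _ _ p_gt0 q_gt0 pq).
have mfA : measurable_fun setT (f \_ A).
  by apply/(measurable_restrictT f mA); exact: measurable_funS mf.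
have mhA : measurable_fun setT (h \_ A).
  by apply/(measurable_restrictT h mA); exact: measurable_funS mh.
move=> /(_ mfA mhA).
have hE : 'N[mu]_q%:E[EFin \o h \_ A] = 1.
  rewrite unlock -[RHS](poweR1r q^-1) -g1 [in RHS]integral_mkcond.
  congr (_ `^ _); apply: eq_integral => x _ /=; rewrite /patch; case: ifP => _.
    rewrite ger0_norm ?powR_ge0// -powRrM /q mulrCA divff ?mulr1//.
    by rewrite gt_eqF.
  by rewrite normr0 powR0// gt_eqF.
have fE : 'N[mu]_p%:E[EFin \o f \_ A] =
    (\int[mu]_(x in A) (`|f x| `^ p)%:E) `^ p^-1.
  rewrite unlock [in RHS]integral_mkcond.
  congr (_ `^ _); apply: eq_integral => x _ /=; rewrite /patch; case: ifP => //= _.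
  by rewrite normr0 powR0.
rewrite hE mule1 fE Lnorm1; apply: le_trans.
rewrite integral_mkcond le_eqVlt; apply/orP; left; apply/eqP.
apply: eq_integral => x _ /=; rewrite /patch; case: ifP => _ //=.
by rewrite mulr0 normr0.
Qed.

Section blocks.
Variables (N : T -> nat) (G : T -> R).
Hypothesis mN : measurable_fun setT N.
Hypothesis mG : measurable_fun setT G.
Hypothesis G_ge0 : (forall x, 0 <= G x)%R.
Hypothesis G_normalized :
  forall n, \int[mu]_(x in N @^-1` [set n]) (G x `^ p)%:E = 1.

Local Notation block n := (N @^-1` [set n]).

Let measurable_block n : measurable (block n).
Proof. by rewrite -[X in measurable X]setTI; exact: mN. Qed.

Lemma ge0_integral_blocks (F : T -> \bar R) : measurable_fun setT F ->
  (forall x, 0 <= F x) ->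
  \int[mu]_x F x = \sum_(n <oo) \int[mu]_(x in block n) F x.
Proof.
move=> mF F0; have TE : setT = \bigcup_n block n.
  by apply/seteqP; split=> // x _; exists (N x).
rewrite [in LHS]TE ge0_integral_bigcup//; first by rewrite -TE.
by move=> i j _ _ [x [/= <- <-]].
Qed.

Definition block_comb (a : nat -> R) (x : T) : R := (a (N x) * G x)%R.

Lemma measurable_block_comb a : measurable_fun setT (block_comb a).
Proof.
apply: measurable_funM => //.
by apply: (@measurableT_comp _ _ _ _ _ _ a).
Qed.

Lemma integral_block_comb a : \int[mu]_x (`|block_comb a x| `^ p)%:E =
  \sum_(n <oo) (`|a n| `^ p)%:E.
Proof.
rewrite ge0_integral_blocks; last 2 first.
- by apply: measurable_normX; exact: measurable_block_comb.
- by move=> x; rewrite lee_fin powR_ge0.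
apply: eq_eseriesr => n _.
transitivity (\int[mu]_(x in block n) ((`|a n| `^ p)%:E * (G x `^ p)%:E)).
  apply: eq_integral => x; rewrite inE /= => <-.
  by rewrite /block_comb normrM powRM// (ger0_norm (G_ge0 x)).
rewrite ge0_integralZl//; first by rewrite G_normalized mule1.
- apply/measurable_EFinP/measurable_funTS.
  exact: (@measurableT_comp _ _ _ _ _ _ (@powR R ^~ p)).
- by move=> x _; rewrite lee_fin powR_ge0.
Qed.

(** The pairing of [f] with [g_n ^ (p - 1)], the functional of norm one that takes the value 1 at
    [g_n]. *)
Definition block_coef (f : T -> R) (n : nat) : R :=
  (\int[mu]_(x in block n) (f x * G x `^ (p - 1)))%R.

Section coef.
Variable f : T -> R.
Hypothesis f_Lp : f \in Lfun mu p%:E.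

Let mf : measurable_fun setT f.
Proof. by move: f_Lp => /andP[/[1!inE]]. Qed.

Let integral_lty : \int[mu]_x (`|f x| `^ p)%:E < +oo.
Proof.
have /integrableP[_] := Lfun_integrable p_ge1 f_Lp.
by under eq_integral do rewrite gee0_abs ?lee_fin ?powR_ge0//.
Qed.

Let block_lty n : \int[mu]_(x in block n) (`|f x| `^ p)%:E < +oo.
Proof.
apply: le_lt_trans integral_lty; apply: ge0_subset_integral => //.
  exact: measurable_normX.
Qed.

Lemma integrable_block n :
  mu.-integrable (block n) (fun x => (f x * G x `^ (p - 1))%:E).
Proof.
apply/integrableP; split.
  apply/measurable_EFinP/measurable_funTS/measurable_funM => //.
  exact: (@measurableT_comp _ _ _ _ _ _ (@powR R ^~ (p - 1)%R)).
apply: le_lt_trans (hoelder_duality _ mf mG G_ge0 (G_normalized n)) _ => //.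
exact/poweR_lty/block_lty.
Qed.

(** The p-th power of the Hoelder bound on one block; summed over the blocks it makes the
    coefficient map a contraction into l_p. *)
Lemma block_coef_le n : (`|block_coef f n| `^ p)%:E <=
  \int[mu]_(x in block n) (`|f x| `^ p)%:E.
Proof.
rewrite -[leRHS]poweRe1; last first.
  by apply: integral_ge0 => x _; rewrite lee_fin powR_ge0.
rewrite -(mulVf p_neq0) poweRrM -poweR_EFin.
apply: gt0_ler_poweR;
  rewrite ?in_itv /= ?lee_fin ?normr_ge0 ?poweR_ge0 ?leey ?(ltW p_gt0)//.
apply: le_trans (hoelder_duality _ mf mG G_ge0 (G_normalized n)) => //.
have coef_fin := integrable_fin_num (measurable_block n) (integrable_block n).
rewrite /block_coef /Rintegral -fine_abse// fineK ?abse_fin_num//.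
apply: le_abse_integral => //.
by case/integrableP: (integrable_block n).
Qed.

Lemma block_coef_summable : \sum_(n <oo) (`|block_coef f n| `^ p)%:E <=
  \int[mu]_x (`|f x| `^ p)%:E.
Proof.
rewrite ge0_integral_blocks; last 2 first.
- exact: measurable_normX.
- by move=> x; rewrite lee_fin powR_ge0.
apply: lee_nneseries => [n _ _|n _]; last exact: block_coef_le.
by rewrite lee_fin powR_ge0.
Qed.

End coef.
Lemma block_coef_comb a n : block_coef (block_comb a) n = a n.
Proof.
rewrite /block_coef /Rintegral.
transitivity (fine (\int[mu]_(x in block n) ((a n)%:E * (G x `^ p)%:E))).
  congr fine; apply: eq_integral => x; rewrite inE /= => <-.
  by rewrite /block_comb -mulrA mulr_powRB1.
have mGp : measurable_fun (block n) (fun x => (G x `^ p)%:E).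
  apply/measurable_EFinP/measurable_funTS.
  exact: (@measurableT_comp _ _ _ _ _ _ (@powR R ^~ p)).
have iGp : mu.-integrable (block n) (fun x => (G x `^ p)%:E).
  apply/integrableP; split => //.
  under eq_integral do rewrite gee0_abs ?lee_fin ?powR_ge0//.
  by rewrite G_normalized ltry.
by rewrite integralZl// G_normalized mule1.
Qed.

Lemma ae_eq_block_coef (f g : T -> R) n :
  measurable_fun setT f -> measurable_fun setT g -> f = g %[ae mu] ->
  block_coef f n = block_coef g n.
Proof.
move=> mf mg fg; congr fine.
have mGp : measurable_fun setT (fun x => G x `^ (p - 1))%R.
  exact: (@measurableT_comp _ _ _ _ _ _ (@powR R ^~ (p - 1)%R)).
apply: ae_eq_integral => //.
- by apply/measurable_EFinP/measurable_funTS/measurable_funM.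
- by apply/measurable_EFinP/measurable_funTS/measurable_funM.
by apply: filterS fg => x /(_ I) /= ->.
Qed.

Lemma block_coefP c (f g : T -> R) n :
  f \in Lfun mu p%:E -> g \in Lfun mu p%:E ->
  block_coef (fun x => c * f x + g x)%R n =
  (c * block_coef f n + block_coef g n)%R.
Proof.
move=> /integrable_block-/(_ n) fi /integrable_block-/(_ n) gi.
rewrite /block_coef -RintegralZl// -RintegralD//; last first.
  exact: (integrableZl _ c fi).
by apply: eq_Rintegral => x _; rewrite mulrDl mulrA.
Qed.

Let LspaceType_mfun (f : LspaceType mu p1) : measurable_fun setT (f : T -> R).
Proof. exact: (@measurable_funP _ _ _ _ setT (Lspace_repr f)). Qed.

Lemma Lnorm_block_comb (a : ell p1) :
  'N[mu]_p%:E[EFin \o block_comb a] = `|a|%:E.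
Proof. by rewrite ell_normE -integral_block_comb unlock. Qed.

Lemma block_comb_Lfun (a : ell p1) : block_comb a \in Lfun mu p%:E.
Proof.
apply/andP; split; rewrite inE /=; first exact: measurable_block_comb.
by rewrite /finite_norm Lnorm_block_comb ltry.
Qed.

(** [J] sends [a] to the class of [block_comb a]; [S] sends [f] to the sequence of its coefficients,
    which lies in l_p by [block_coef_summable]. *)
Lemma block_isometry : exists (J : {linear ell p1 -> LspaceType mu p1})
    (S : {linear LspaceType mu p1 -> ell p1}),
  [/\ forall a, (J a : T -> R) = block_comb a %[ae mu],
      forall a, (`|J a| = `|a|)%R, forall f, (`|S f| <= `|f|)%R & cancel J S].
Proof.
pose J0 (a : ell p1) : LspaceType mu p1 :=
  Lspace_pi (Lfun_Sub p1 (block_comb_Lfun a)).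
have J0E a : (J0 a : T -> R) = block_comb a %[ae mu] by exact: Lspace_piE.
have J0_lin : linear J0.
  move=> c a b; apply/LspaceP.
  apply: filterS2 (filterI (LspaceZE c (J0 a)) (LspaceDE (c *: J0 a) (J0 b)))
    (filterI (filterI (J0E a) (J0E b)) (J0E (c *: a + b)%R)) => x.
  move=> [/(_ I) ZE /(_ I) DE] [[/(_ I) aE /(_ I) bE] /(_ I) cE] _.
  rewrite cE DE /= ZE /= aE bE /block_comb ell_linE.
  by rewrite mulrDl -mulrA.
have S0P (f : LspaceType mu p1) :
    exists y : ell p1, forall n, y n = block_coef f n.
  apply: ell_exists; apply: le_lt_trans (block_coef_summable _) _.
    exact: Lspace_repr_subproof.
  have /integrableP[_] := Lfun_integrable p_ge1 (Lspace_repr_subproof f).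
  by under eq_integral do rewrite gee0_abs ?lee_fin ?powR_ge0//.
have [S0 S0E] := choice S0P.
have S0_lin : linear S0.
  (* The representative of [c *: f + g] equals the combination of representatives only almost
     everywhere, a difference that the coefficients do not see. *)
  move=> c f g; apply/ellP => n; rewrite ell_linE !S0E.
  rewrite -block_coefP ?Lspace_repr_subproof//; apply: ae_eq_block_coef.
  - exact: LspaceType_mfun.
  - apply: measurable_funD; last exact: LspaceType_mfun.
    by apply: measurable_funM => //; exact: LspaceType_mfun.
  - apply: filterS2 (LspaceZE c f) (LspaceDE (c *: f) g).
    by move=> x /(_ I) ZE /(_ I) DE _; rewrite DE /= ZE.
pose J := HB.pack_for {linear ell p1 -> LspaceType mu p1} J0
  (GRing.isLinear.Build _ _ _ _ J0 J0_lin).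
pose S := HB.pack_for {linear LspaceType mu p1 -> ell p1} S0
  (GRing.isLinear.Build _ _ _ _ S0 S0_lin).
exists J, S; split=> //=.
- move=> a; apply: EFin_inj; rewrite Lspace_normE -Lnorm_block_comb.
  apply: ae_eq_Lnorm (J0E a) => //.
  exact: measurable_block_comb.
- move=> f; rewrite -lee_fin ell_normE Lspace_normE Lnorm.unlock.
  have pV : (0 <= p^-1)%R by rewrite invr_ge0 ltW.
  apply: gt0_ler_poweR => //.
  + rewrite in_itv /= leey andbT; apply: nneseries_ge0 => n _ _.
    by rewrite lee_fin powR_ge0.
  + rewrite in_itv /= leey andbT; apply: integral_ge0 => x _.
    by rewrite lee_fin powR_ge0.
  + under eq_eseriesr do rewrite S0E.
    exact: block_coef_summable (Lspace_repr_subproof f).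
- move=> a; apply/ellP => n; rewrite S0E -(block_coef_comb a n).
  apply: ae_eq_block_coef (J0E a); first exact: LspaceType_mfun.
  exact: measurable_block_comb.
Qed.
End blocks.
End block_basis.

(** * A bijection between pairs of naturals and naturals *)

(** Every positive integer is uniquely [2 ^ n * (2 i + 1)]; the shift by one makes the codes start
    at 0. The label is the 2-adic valuation, the index comes from the odd part. *)
Definition dyadic_code (n i : nat) : nat := (2 ^ n * i.*2.+1).-1.
Definition dyadic_label (j : nat) : nat := logn 2 j.+1.
Definition dyadic_index (j : nat) : nat := (j.+1 %/ 2 ^ dyadic_label j)./2.

Lemma dyadic_codeS n i : (dyadic_code n i).+1 = (2 ^ n * i.*2.+1)%N.
Proof. by rewrite prednK// muln_gt0 expn_gt0. Qed.

Lemma dyadic_label_code n i : dyadic_label (dyadic_code n i) = n.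
Proof.
rewrite /dyadic_label dyadic_codeS lognM ?expn_gt0// pfactorK//.
by rewrite logn_coprime ?addn0// coprime2n /= odd_double.
Qed.

Lemma dyadic_index_code n i : dyadic_index (dyadic_code n i) = i.
Proof.
rewrite /dyadic_index dyadic_label_code dyadic_codeS mulKn ?expn_gt0//.
by rewrite -[i.*2.+1]/(true + i.*2)%N half_bit_double.
Qed.

Lemma dyadic_codeK j : dyadic_code (dyadic_label j) (dyadic_index j) = j.
Proof.
have [m om jE] : exists2 m, odd m & j.+1 = (2 ^ dyadic_label j * m)%N.
  have [m cm jE] := pfactor_coprime (isT : prime 2) (ltn0Sn j).
  by exists m; [rewrite -coprime2n | rewrite mulnC].
have := odd_double_half m; rewrite om add1n => mE.
by rewrite /dyadic_code /dyadic_index jE mulKn ?expn_gt0// mE -jE.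
Qed.

Lemma leq_dyadic_code n i : (i <= dyadic_code n i)%N.
Proof.
rewrite -ltnS dyadic_codeS -addnn; have := expn_gt0 2 n; nia.
Qed.

(** * Disjoint sets of positive, rapidly decreasing measure in [0, 1] *)

Section layered_intervals.
Local Open Scope ereal_scope.
Context (R : realType) (r : nat -> R).
Hypothesis r01 : forall j, (0 <= r j <= 1)%R.

(** A square in the exponent makes the decay beat [2 ^ (c * j)] for every [c], as integrals with [q]
    close to [p] require. As [width 0 = 1], layer 0 is all of [0, 1]. *)
Definition width (j : nat) : R := (4^-1 ^+ (j ^ 2))%R.

Lemma width_gt0 j : (0 < width j)%R.
Proof. by rewrite exprn_gt0. Qed.

Lemma width_le1 j : (width j <= 1)%R.
Proof. by rewrite exprn_ile1// invf_le1// ler1n. Qed.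

(** Shaped for a geometric sum over [i]: all layers after [j] together have measure at most
    [width j / 2]. *)
Lemma width_decay j i : (width (j.+1 + i)%N <= width j / 2 / (2 ^ i.+1)%:R)%R.
Proof.
rewrite /width -mulrA -invfM -natrM -expnS natrX -exprVn.
apply: (@le_trans _ _ (4^-1 ^+ (j ^ 2 + i.+1))%R).
  apply: ler_wiXn2l; rewrite ?invr_ge0 ?invf_le1// ?ler1n//; nia.
rewrite exprD ler_pM2l ?exprn_gt0//.
rewrite (_ : 4^-1 = 2^-1 ^+ 2 :> R)%R; last by rewrite exprVn -natrX.
by rewrite -exprM; apply: ler_wiXn2l; rewrite ?invr_ge0 ?invf_le1// ?ler1n//; nia.
Qed.

(* Scaling [0, 1] towards [r j] keeps the interval inside [0, 1], even when [r j]
   is an endpoint. *)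
Definition layer (j : nat) : set (measurableTypeR R) :=
  `[((1 - width j) * r j)%R, ((1 - width j) * r j + width j)%R]%classic.

Lemma measurable_layer j : measurable (layer j).
Proof. exact: measurable_itv. Qed.

Lemma layer_sub01 j : layer j `<=` `[0%R, 1%R].
Proof.
move=> x; rewrite /layer /= !in_itv /= => /andP[lx xu].
have /andP[r0 r1] := r01 j; have w0 := width_gt0 j; have w1 := width_le1 j.
by apply/andP; split; nra.
Qed.

Lemma layer_near j x : layer j x -> (`|x - r j| <= width j)%R.
Proof.
rewrite /layer /= in_itv /= => /andP[lx xu].
have /andP[r0 r1] := r01 j; have w0 := width_gt0 j; have w1 := width_le1 j.
by rewrite ler_norml; apply/andP; split; nra.
Qed.

Lemma lebesgue01_layer j : lebesgue01 R (layer j) = (width j)%:E.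
Proof.
rewrite /lebesgue01 /= /mrestr setIidl; last exact: layer_sub01.
rewrite lebesgue_measure_itv /= lte_fin ltrDl width_gt0 -EFinB.
by congr EFin; ring.
Qed.

(** The points for which [j] is the last index of a layer containing them; hence these sets are
    disjoint. *)
Definition top_layer (j : nat) : set (measurableTypeR R) :=
  layer j `\` \bigcup_i layer (j.+1 + i)%N.

Lemma measurable_top_layer j : measurable (top_layer j).
Proof.
by apply: measurableD; [|apply: bigcup_measurable => i _]; exact: measurable_layer.
Qed.

Lemma top_layer_inj x i j : top_layer i x -> top_layer j x -> i = j.
Proof.
wlog ij : i j / (i <= j)%N.
  by move=> H xi xj; have [/H->|/ltnW/H->] := leqP i j.
move=> [_ xi] [xj _]; apply/eqP; rewrite eqn_leq ij leqNgt; apply/negP => ltij.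
by apply: xi; exists (j - i.+1)%N => //; rewrite subnKC.
Qed.

(** The later layers have total measure at most half that of [layer j], so they cannot cover it. *)
Lemma lebesgue01_top_layer_gt0 j : 0 < lebesgue01 R (top_layer j).
Proof.
set U := \bigcup_i layer (j.+1 + i)%N.
have mU : measurable U by apply: bigcup_measurable => i _; exact: measurable_layer.
have U_le : lebesgue01 R U <= (width j / 2)%:E.
  apply: le_trans (epsilon_trick0 xpredT _); last first.
    by rewrite divr_ge0// ltW// width_gt0.
  have mF i : measurable (layer (j.+1 + i)%N) by exact: measurable_layer.
  have H := measure_sigma_subadditive (lebesgue01 R) mF mU (@subset_refl _ U).
  apply: le_trans H _.
  apply: lee_nneseries => [i _ _|i _]; first exact: measure_ge0.
  by rewrite lebesgue01_layer lee_fin width_decay.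
rewrite ltNge; apply/negP => top0.
have : lebesgue01 R (layer j) <= lebesgue01 R (top_layer j) + lebesgue01 R U.
  apply: le_trans (measureU2 _ _ _) => //; last exact: measurable_top_layer.
  apply: le_measure; rewrite ?inE.
  - exact: measurable_layer.
  - by apply: measurableU => //; exact: measurable_top_layer.
  - by move=> x xj; have [xU|xU] := pselect (U x); [right|left].
rewrite lebesgue01_layer; apply/negP; rewrite -ltNge.
apply: le_lt_trans (leeD top0 U_le) _.
by rewrite add0e lte_fin ltr_pdivrMr// mulr_natr mulr2n ltrDl width_gt0.
Qed.

(* The default [0] is taken on the null set of points lying in infinitely many
   layers. *)
Definition layer_of (x : measurableTypeR R) : nat :=
  xget 0%N [set j | top_layer j x].

Lemma layer_ofE j x : top_layer j x -> layer_of x = j.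
Proof. by move=> xj; apply: xget_unique => //= i xi; exact: top_layer_inj xi xj. Qed.

Lemma top_layer_of x : (0 < layer_of x)%N -> top_layer (layer_of x) x.
Proof.
rewrite /layer_of; by case: xgetP => [j -> //|_]; rewrite ltnn.
Qed.

Lemma preimage_layer_of j : (0 < j)%N -> layer_of @^-1` [set j] = top_layer j.
Proof.
move=> j0; apply/seteqP; split=> [x /= xj|x]; last exact: layer_ofE.
by rewrite -xj; apply: top_layer_of; rewrite xj.
Qed.

Lemma measurable_layer_of : measurable_fun setT layer_of.
Proof.
have mpos j : (0 < j)%N -> measurable (layer_of @^-1` [set j]).
  by move=> /preimage_layer_of ->; exact: measurable_top_layer.
have m1 j : measurable (layer_of @^-1` [set j]).
  case: j => [|j]; last exact: mpos.
  (* The fibre over 0 also contains the default points, so it is treated as the complement of the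
     other fibres. *)
  rewrite -[X in measurable X]setCK; apply: measurableC.
  rewrite (_ : ~` _ = \bigcup_j (layer_of @^-1` [set j.+1])).
    by apply: bigcup_measurable => j _; exact: mpos.
  apply/seteqP; split=> x /=; last by move=> [j _ /= ->].
  by case E : (layer_of x) => [|j] // _; exists j.
move=> _ Y _.
rewrite setTI (_ : _ @^-1` Y = \bigcup_(j in Y) (layer_of @^-1` [set j])).
  by apply: bigcup_measurable => j _; exact: m1.
by apply/seteqP; split=> x /=; [exists (layer_of x) | move=> [j /= Yj ->]].
Qed.

Lemma lebesgue01_layer_of_gt0 j : 0 < lebesgue01 R (layer_of @^-1` [set j]).
Proof.
apply: lt_le_trans (lebesgue01_top_layer_gt0 j) _.
apply: le_measure; rewrite ?inE.
- exact: measurable_top_layer.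
- by rewrite -[X in measurable X]setTI; exact: measurable_layer_of.
- by move=> x /layer_ofE.
Qed.

Lemma lebesgue01_layer_of_le j :
  (0 < j)%N -> lebesgue01 R (layer_of @^-1` [set j]) <= (width j)%:E.
Proof.
move=> /preimage_layer_of ->; rewrite -lebesgue01_layer.
apply: le_measure; rewrite ?inE.
- exact: measurable_top_layer.
- exact: measurable_layer.
- by move=> x [].
Qed.

End layered_intervals.

(* With [w = 2^-(i+1)], a set of measure [K] carrying the constant [(w / K)^(1/p)]
   contributes [w] to the p-th power integral and [(w / K)^(1+t) K] to the q-th
   one, where [1 + t = q / p]. *)
Lemma spike_growth (R : realType) (i : nat) (t K : R) : 0 < t -> 0 < K ->
  K <= 4^-1 ^+ (i ^ 2) -> 2 <= t * i.-1%:R ->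
  2 ^+ i.+1 <= (2^-1 ^+ i.+1 / K) `^ (1 + t) * K.
Proof.
move=> t0 K0 Ki ti.
have i_gt0 : (0 < i)%N by case: i ti {Ki} => //=; rewrite mulr0 lern0.
set B : R := 2 ^+ i.+1.
have B1 : 1 <= B by rewrite exprn_ege1// ler1n.
have B0 : 0 < B by exact: lt_le_trans ltr01 B1.
have wB : 2^-1 ^+ i.+1 = B^-1 by rewrite exprVn.
rewrite wB.
(* This amounts to [B ^ i * K <= 1], which holds since [(i + 1) * i <= 2 * i ^ 2]. *)
have wK : B ^+ i.-1 <= B^-1 / K.
  rewrite ler_pdivlMr// -[leRHS]mulr1 ler_pdivlMl// mulrA -exprS prednK//.
  apply: le_trans (ler_wpM2l (exprn_ge0 _ (ltW B0)) Ki) _.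
  rewrite exprVn ler_pdivrMr ?exprn_gt0// mul1r /B -exprM.
  rewrite (_ : 4 = 2 ^+ 2 :> R); last by rewrite -natrX.
  by rewrite -exprM ler_weXn2l ?ler1n//; nia.
have wK0 : 0 < B^-1 / K by rewrite divr_gt0// invr_gt0.
(* One factor [B^-1 / K] cancels [K]. It remains to bound [(B^-1 / K) ^ t] below by [B ^ 2], and it
   is at least [B ^ (t * (i - 1))]. *)
rewrite powRD; last by rewrite (gt_eqF wK0) implybT.
rewrite powRr1 ?(ltW wK0)// mulrAC divfK ?gt_eqF//.
rewrite ler_pdivlMl//.
apply: le_trans (_ : (B ^+ i.-1) `^ t <= _); last first.
  by rewrite ge0_ler_powR ?(ltW t0)// nnegrE ?exprn_ge0 ?(ltW B0) ?(ltW wK0).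
rewrite -powR_mulrn ?(ltW B0)// -powRrM -expr2 -powR_mulrn ?(ltW B0)//.
by rewrite ler_powR// mulrC.
Qed.

(** * The spikes and their behaviour on open sets *)

Section spikes.
Context (R : realType).

(** The value 0 for unsuitable codes keeps every term in [0, 1], as the layers require of their
    centers. *)
Definition rational01 (k : nat) : R :=
  if unpickle k is Some q then
    if 0 <= (ratr q : R) <= 1 then ratr q else 0
  else 0.

Lemma rational01_itv k : 0 <= rational01 k <= 1.
Proof.
rewrite /rational01; case: unpickle => [q|]; last by rewrite lexx ler01.
by case: ifP => // _; rewrite lexx ler01.
Qed.

Lemma rational01_dense (a b : R) : 0 <= a -> a < b -> b <= 1 ->
  exists k, a < rational01 k < b.
Proof.
move=> a0 ab b1; have [q] := rat_in_itvoo ab; rewrite in_itv /= => /andP[aq qb].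
exists (pickle q); rewrite /rational01 pickleK.
by rewrite (le_trans a0 (ltW aq)) (le_trans (ltW qb) b1) /= aq qb.
Qed.

(* Each pair of a label and a rational of [0, 1] is attained by infinitely many [j]. *)
Definition center (j : nat) : R := rational01 (dyadic_label (dyadic_index j)).

Let center01 j : 0 <= center j <= 1. Proof. exact: rational01_itv. Qed.

Local Notation level := (layer_of center).
Local Notation leb := (@lebesgue_measure R).

Lemma measurable_level j : measurable (level @^-1` [set j]).
Proof. by rewrite -[X in measurable X]setTI; exact: measurable_layer_of. Qed.

(** A layer stays within [width j] of its center. So it suffices to choose [j] with label [n],
    center at a rational inside the open set, and index so large that the width is below the
    distance to the boundary. *)
Lemma open_level_sub (O : set R) n M : open O -> `[0, 1]%classic `&` O !=set0 ->
  exists2 i, (M <= i)%N &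
    level @^-1` [set dyadic_code n i] `<=` `[0, 1]%classic `&` O.
Proof.
move=> oO [x [/=]]; rewrite in_itv /= => /andP[x0 x1] Ox.
have /nbhs_ballP[e /= e0 xeO] := open_nbhs_nbhs (conj oO Ox).
(* Clipping to [0, 1] still leaves an interval of positive length, also when [x] is an endpoint. *)
pose a := Num.max 0 (x - e); pose b := Num.min 1 (x + e).
have ab : a < b.
  rewrite /a /b gt_max !lt_min ltr01/=.
  by apply/andP; split; [|apply/andP; split]; lra.
have [k /andP[ak kb]] : exists k, a < rational01 k < b.
  by apply: rational01_dense => //; rewrite ?le_max ?ge_min lexx.
pose e' := Num.min (rational01 k - a) (b - rational01 k).
have e'0 : 0 < e' by rewrite lt_min !subr_gt0 ak kb.
pose m := Num.bound e'^-1.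
have me : 4^-1 ^+ m < e'.
  have em : e'^-1 < m%:R by apply: archi_boundP; rewrite invr_ge0 ltW.
  rewrite exprVn invf_plt ?posrE ?exprn_gt0//; apply: lt_le_trans em _.
  by rewrite -natrX ler_nat ltnW// ltn_expl.
(* The label [k] of [i] puts the center of [j] at [rational01 k]; the second component forces [i]
   above both [M] and [m]. *)
pose i := dyadic_code k (M + m).+1.
have im : (M + m < i)%N by exact: leq_dyadic_code.
exists i; first by lia.
set j := dyadic_code n i.
have ij : (i <= j)%N by exact: leq_dyadic_code.
have j0 : (0 < j)%N by lia.
move=> y; rewrite (preimage_layer_of _ j0) => -[yj _].
split; first exact: (layer_sub01 center01) yj.
apply: xeO; rewrite /ball /=.
have := layer_near center01 yj.
rewrite {1}/center dyadic_index_code dyadic_label_code => yk.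
have wj : width R j < e'.
  apply: le_lt_trans me; apply: ler_wiXn2l; rewrite ?invr_ge0 ?invf_le1// ?ler1n//.
  nia.
have := le_lt_trans yk wj; rewrite lt_min => /andP[].
rewrite !ltr_norml /a /b in ak kb *; move=> /andP[h1 h2] /andP[h3 h4].
have h5 : x - e <= Num.max 0 (x - e) by rewrite le_max lexx orbT.
have h6 : Num.min 1 (x + e) <= x + e by rewrite ge_min lexx orbT.
by apply/andP; split; lra.
Qed.

Definition mass (j : nat) : R := fine (lebesgue01 R (level @^-1` [set j])).

Lemma mass_fineK j : (mass j)%:E = lebesgue01 R (level @^-1` [set j]).
Proof.
rewrite fineK// ge0_fin_numE ?measure_ge0//.
apply: (@le_lt_trans _ _ (lebesgue01 R setT)).
  by apply: le_measure; rewrite ?inE//; exact: measurable_level.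
rewrite /lebesgue01 /= /mrestr setTI lebesgue_measure_itv /= lte01 -EFinB.
exact: ltry.
Qed.

Lemma mass_gt0 j : 0 < mass j.
Proof. by rewrite -lte_fin mass_fineK; exact: lebesgue01_layer_of_gt0. Qed.

Variable p : R.
Hypothesis p1 : (1 <= p%:E)%E.

Let p_gt0 : 0 < p.
Proof. by rewrite (lt_le_trans ltr01) // -lee_fin. Qed.

(** Chosen so that level [j] has p-th power integral [2 ^- (i + 1)], with [i] the index of [j]; over
    one label these sum to 1. *)
Definition height (j : nat) : R := (2^-1 ^+ (dyadic_index j).+1 / mass j) `^ p^-1.

Definition spike_label (x : measurableTypeR R) : nat := dyadic_label (level x).
Definition spike (x : measurableTypeR R) : R := height (level x).

Lemma spike_ge0 x : 0 <= spike x. Proof. exact: powR_ge0. Qed.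

Lemma measurable_spike_label : measurable_fun setT spike_label.
Proof.
apply: (@measurableT_comp _ _ _ _ _ _ dyadic_label) => //.
exact: measurable_layer_of.
Qed.

Lemma measurable_spike : measurable_fun setT spike.
Proof.
apply: (@measurableT_comp _ _ _ _ _ _ height) => //.
exact: measurable_layer_of.
Qed.

Lemma spike_normalized n :
  (\int[lebesgue01 R]_(x in spike_label @^-1` [set n]) (spike x `^ p)%:E = 1)%E.
Proof.
have -> : spike_label @^-1` [set n] =
    \bigcup_i (level @^-1` [set dyadic_code n i]).
  apply/seteqP; split=> x /=; rewrite /spike_label.
    by move=> <-; exists (dyadic_index (level x)) => //=; rewrite dyadic_codeK.
  by move=> [i _ /= ->]; rewrite dyadic_label_code.
rewrite ge0_integral_bigcup//; last 4 first.
- by move=> i; exact: measurable_level.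
- apply/measurable_EFinP/measurable_funTS.
  apply: (@measurableT_comp _ _ _ _ _ _ (@powR R ^~ p)) => //.
  exact: measurable_spike.
- by move=> x _; rewrite lee_fin powR_ge0.
- move=> i j _ _ [x [/= -> /(congr1 dyadic_index)]].
  by rewrite !dyadic_index_code.
under eq_eseriesr => i _.
  rewrite (_ : (\int[_]_(x in _) _)%E = (1 / (2 ^ (i + 1))%:R)%:E); first over.
  set j := dyadic_code n i.
  transitivity (\int[lebesgue01 R]_(x in level @^-1` [set j])
      (cst (height j `^ p)%:E x))%E.
    by apply: eq_integral => x; rewrite inE /= /spike => ->.
  rewrite integral_cst; last exact: measurable_level.
  rewrite -mass_fineK -EFinM /height -powRrM mulVf ?gt_eqF// powRr1; last first.
    by rewrite divr_ge0 ?exprn_ge0 ?(ltW (mass_gt0 _)).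
  by rewrite divfK ?gt_eqF ?mass_gt0// dyadic_index_code addn1 natrX exprVn div1r.
have := @cvg_geometric_eseries_half R 1 0.
by rewrite expr0 divr1 => /cvg_lim; apply.
Qed.

(** Each relatively open set contains level sets with label [n] and index [i] arbitrarily large. On
    such a set the r-th power integral is at least [|a n| ^ r * 2 ^ (i + 1)], hence there is no
    finite bound. *)
Lemma nowhere_block_comb (a : nat -> R) (n : nat) (q : \bar R) : a n != 0 ->
  (p%:E < q)%E -> nowhere_Lfun q (block_comb spike_label spike a).
Proof.
(* On a set of finite measure an essentially bounded function is in L^(p+1), so [q = +oo] reduces to
   [q = p + 1]. *)
wlog [r ->] : q / exists r, q = r%:E.
  move=> H an; case: q => [r pr|_|//]; first by apply: H => //; exists r.
  have p1y : (p%:E < (p + 1)%:E)%E by rewrite lte_fin ltrDl.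
  move=> O oO O0; have := H (p + 1)%:E _ an p1y O oO O0.
  move=> /(_ (ex_intro _ _ erefl)); apply: contra; apply: Lfun_subset => //.
  - by have := p1; rewrite !lee_fin; lra.
  - exact: leey.
  - rewrite ge0_fin_numE ?measure_ge0//.
    apply: (@le_lt_trans _ _ (lebesgue01 R setT)).
      rewrite /lebesgue01 /= /mrestr !setTI; apply: le_measure; rewrite ?inE//.
      exact: measurable_relopen.
    rewrite /lebesgue01 /= /mrestr setTI lebesgue_measure_itv /= lte01 -EFinB.
    exact: ltry.
  - exact: leey.
move=> an; rewrite lte_fin => pr O oO O0; apply/negP => /[dup] fL.
set f := block_comb _ _ _ in fL *.
set nu := mrestr _ _ in fL *.
have r_gt0 : 0 < r by exact: lt_trans p_gt0 pr.
have r_ge1 : 1 <= r by rewrite (le_trans _ (ltW pr))// -lee_fin.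
move=> /(Lfun_integrable r_ge1)/integrableP[_].
under eq_integral do rewrite gee0_abs ?lee_fin ?powR_ge0//.
apply/negP; rewrite -leNgt leye_eq; apply/eqP/eqyP => A A0.
pose t := r / p - 1.
have t0 : 0 < t by rewrite subr_gt0 ltr_pdivlMr// mul1r.
pose s := `|a n| `^ r.
have s0 : 0 < s by rewrite powR_gt0// normr_gt0.
(* The first bound gives [2 <= t * (i - 1)], its extra successor paying for the [- 1]; the second
   gives [A <= s * 2 ^ (i + 1)]. *)
pose M := (maxn (Num.bound (2 / t)).+1 (Num.bound (A / s))).+1.
have [i Mi iO] := @open_level_sub O n M oO O0.
have /andP[Mi1 Mi2] : ((Num.bound (2 / t)).+1 < i)%N && (Num.bound (A / s) < i)%N.
  by rewrite -gtn_max.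
pose j := dyadic_code n i.
have ti : 2 <= t * i.-1%:R.
  rewrite -ler_pdivrMl// mulrC; apply/ltW/(lt_le_trans (archi_boundP _)).
    by rewrite divr_ge0 ?(ltW t0).
  by rewrite ler_nat -ltnS prednK ?(ltnW Mi1)// (leq_ltn_trans _ Mi1).
have As : A <= s * 2 ^+ i.+1.
  rewrite -ler_pdivrMl// mulrC; apply/ltW/(lt_le_trans (archi_boundP _)).
    by rewrite divr_ge0 ?(ltW s0) ?(ltW A0).
  rewrite -natrX ler_nat; apply: leq_trans (ltnW (ltn_expl _ (isT : 1 < 2)%N)).
  by rewrite leqW// ltnW.
have jwidth : mass j <= 4^-1 ^+ (i ^ 2).
  rewrite -lee_fin mass_fineK.
  apply: le_trans (lebesgue01_layer_of_le center01 _) _.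
    by apply: leq_trans (leq_dyadic_code n i); rewrite (leq_trans _ Mi).
  rewrite lee_fin; apply: ler_wiXn2l; rewrite ?invr_ge0 ?invf_le1// ?ler1n//.
  by rewrite leq_exp2r// leq_dyadic_code.
have growth := spike_growth t0 (mass_gt0 j) jwidth ti.
have mf : measurable_fun setT f.
  apply: measurable_block_comb; first exact: measurable_spike_label.
  exact: measurable_spike.
(* A single level set suffices: there [|f|] is the constant [|a n| * height j]. *)
apply: le_trans
  (_ : \int[nu]_(x in level @^-1` [set j]) (`|f x| `^ r)%:E <= _)%E; last first.
  apply: ge0_subset_integral => //; first exact: measurable_level.
  apply/measurable_EFinP.
  apply: (@measurableT_comp _ _ _ _ _ _ (@powR R ^~ r)) => //.
  exact: measurableT_comp.
have -> : (\int[nu]_(x in level @^-1` [set j]) (`|f x| `^ r)%:E =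
    \int[nu]_(x in level @^-1` [set j]) cst (s * height j `^ r)%:E x)%E.
  apply: eq_integral => x; rewrite inE /= /f /block_comb /spike_label /spike => ->.
  by rewrite dyadic_label_code normrM powRM// (ger0_norm (powR_ge0 _ _)).
rewrite integral_cst; last exact: measurable_level.
(* The level set lies inside [0, 1] and [O], so restricting the measure to them does not change its
   mass. *)
rewrite [X in (_ * X)%E](_ : _ = (mass j)%:E); last first.
  rewrite mass_fineK /nu /= /lebesgue01 /= /mrestr.
  by rewrite (setIidl iO) setIidl// => x /iO[].
rewrite -EFinM lee_fin; apply: le_trans As _.
rewrite -mulrA ler_pM2l//; apply: le_trans growth _.
rewrite /height -powRrM dyadic_index_code /t.
by rewrite (_ : p^-1 * r = 1 + (r / p - 1))//; lra.
Qed.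

End spikes.

(** * The range of the isometry built from the spikes *)

Theorem theorem1p4 (R : realType) (p : R) (p1 : (1 <= p%:E)%E) :
  (exists V : set (L01 p1),
     [/\ closed V, submod_closed (mem V), V `<=` nowhere_Lq p1 `|` [set 0],
         linearly_isometric (ell p1) V & complemented V]) /\
  spaceable (nowhere_Lq p1).
Proof.
have [J [S [JE J_iso S_contr JK]]] := block_isometry p1
  (@measurable_spike_label R) (@measurable_spike R p)
  (@spike_ge0 R p) (spike_normalized p1).
have clV := closed_range S_contr J_iso JK.
have V_nowhere : range J `<=` nowhere_Lq p1 `|` [set 0].
  (* One nonzero coordinate [n] is enough: the spikes with label [n] already spoil integrability on
     every open set. The zero sequence gives the zero class. *)
  move=> _ [a _ <-]; have [[n an]|a0] := pselect (exists n, a n != 0).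
    left=> q pq; apply: nowhere_Lfun_ae (nowhere_block_comb p1 an pq).
    - exact: le_trans p1 (ltW pq).
    - apply: measurable_block_comb; first exact: measurable_spike_label.
      exact: measurable_spike.
    - exact: (@measurable_funP _ _ _ _ setT (Lspace_repr (J a))).
    - by apply: filterS (JE a) => x /(_ I) ->.
  right; rewrite /= (_ : a = 0) ?linear0//; apply/ellP => n.
  by rewrite ell0E; apply/eqP/negP => an; apply: a0; exists n; apply/negP.
split; exists (range J); split=> //.
- exact: submod_closed_range.
- by exists J.
- exact: complemented_range S_contr J_iso JK.
- exact: submod_closed_range.
- have [e eE] := choice (ell_unit_exists p1).
  exact: infinite_dimensional_range (can_inj JK) (ell_unit_free eE).
Qed.
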